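(* Let $a\le 0<b$, let the function $\varphi:[a,b)\to\mathbb{R}$ have derivatives of all orders on $[a,b)$, and let $\varphi(0)=0$. Define the function $f$ on $[a,b)$ by $$f(x)=\begin{cases}\dfrac{\varphi(x)}{x}, & x\in[a,b)\setminus\{0\},\\[2mm] \varphi'(0), & x=0.\end{cases}$$ Then for every $n=0,1,2,\ldots$, $$f^{(n)}(x)=\begin{cases}\dfrac{1}{x^{n+1}}\displaystyle\sum_{k=0}^n\binom{n}{k}(-1)^k k!\,x^{n-k}\varphi^{(n-k)}(x), & x\ne 0,\\[2mm] \dfrac{1}{n+1}\varphi^{(n+1)}(0), & x=0,\end{cases}$$ and $f^{(n)}$ is continuous on $[a,b)$. Moreover, $$\frac{\mathrm{d}}{\mathrm{d}x}\sum_{k=0}^n\binom{n}{k}(-1)^k k!\,x^{n-k}\varphi^{(n-k)}(x)=x^n\varphi^{(n+1)}(x).$$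
   Context: Derivatives at the endpoint $a$ of $[a,b)$ are one-sided. *)

(* Defs.v *)
From HB Require Import structures.
From mathcomp Require Import all_boot all_order all_algebra.
From mathcomp Require Import all_classical all_reals all_analysis.

Set Implicit Arguments.
Unset Strict Implicit.
Unset Printing Implicit Defensive.

Import Order.TTheory GRing.Theory Num.Theory.
Import numFieldNormedType.Exports.

Local Open Scope classical_set_scope.
Local Open Scope ring_scope.

(* [derive1] and [derivable] are two-sided; below, the increment [h] only takes
   values with [h + x] in [A].  For [A = `[a, b[] this is the right derivative
   at [a] and the library derivative at interior points ([incr_in_left_end] and
   [derive_in_interior]).  A function on [A] is a total function whose values
   outside [A] are irrelevant. *)
Definition incr_in (R : realType) (A : set R) (x : R) : set_system R :=
  within [set h | A (h + x)] 0^'.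

Definition derivable_in (R : realType) (A : set R) (f : R -> R) (x : R) : Prop :=
  cvg ((fun h => h^-1 *: (f (h + x) - f x)) @ incr_in A x).

Definition derive_in (R : realType) (A : set R) (f : R -> R) (x : R) : R :=
  lim ((fun h => h^-1 *: (f (h + x) - f x)) @ incr_in A x).

Definition deriven_in (R : realType) (A : set R) (n : nat) (f : R -> R) :
  R -> R := iter n (derive_in A) f.

Definition nderivable_in (R : realType) (A : set R) (n : nat) (f : R -> R) :
  Prop :=
  forall k, (k < n)%N -> forall x, A x -> derivable_in A (deriven_in A k f) x.

(* For [k = n] the factor [x ^+ (n - k)] is [1], also at [x = 0]. *)
Definition leibniz_sum (R : realType) (A : set R) (phi : R -> R) (n : nat)
  (x : R) : R :=
  \sum_(k < n.+1) 'C(n, k)%:R * (-1) ^+ k * k`!%:R * x ^+ (n - k)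
                  * deriven_in A (n - k) phi x.

Lemma incr_in_interior (R : realType) (A : set R) (x : R) :
  nbhs x A -> incr_in A x = 0^'.
Proof.
move=> nA; have hA : \forall h \near (0 : R)^', A (h + x).
  apply: (@nbhs_dnbhs _ (0 : R)).
  have c : (fun h : R => h + x) @ (0 : R) --> (0 + x : R).
    by apply: cvgD; [exact: cvg_id|exact: cvg_cst].
  by apply: c; rewrite add0r.
rewrite /incr_in; apply/seteqP; split=> P hP; last first.
  exact: cvg_within hP.
have {}hP : \forall h \near (0 : R)^', A (h + x) -> P h by [].
by apply: filterS2 hP hA => h /[apply].
Qed.

Lemma incr_in_left_end (R : realType) (a b : R) :
  a < b -> incr_in `[a, b[ a = 0^'+.
Proof.
move=> ab; have hb : \forall h \near (0 : R), h < b - a.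
  by apply: lt_nbhsl; rewrite subr_gt0.
rewrite /incr_in; apply/seteqP; split=> P hP.
  suff : \forall h \near (0 : R), 0 < h -> P h by [].
  have {}hP : \forall h \near (0 : R), h != 0 -> `[a, b[%classic (h + a) -> P h.
    by [].
  apply: filterS2 hb hP => h hb hP h0; apply: hP; first by rewrite gt_eqF.
  by rewrite /= in_itv/= lerDr ltW//= -ltrBrDr.
suff : \forall h \near (0 : R), h != 0 -> `[a, b[%classic (h + a) -> P h by [].
have {}hP : \forall h \near (0 : R), 0 < h -> P h by [].
apply: filterS hP => h hP h0; rewrite /= in_itv/= lerDr => /andP[h1 _].
by apply: hP; rewrite lt_neqAle eq_sym h0.
Qed.

Lemma derivable_in_interior (R : realType) (A : set R) (f : R -> R) (x : R) :
  nbhs x A -> derivable_in A f x <-> derivable f x 1.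
Proof.
move=> nA; rewrite /derivable_in incr_in_interior// /derivable.
have -> : (fun h : R => h^-1 *: (f (h + x) - f x)) =
  (fun h : R => h^-1 *: ((f \o shift x) (h *: (1 : R)) - f x)) => //.
by apply/funext => h; rewrite /= /GRing.scale/= mulr1.
Qed.

Lemma derive_in_interior (R : realType) (A : set R) (f : R -> R) (x : R) :
  nbhs x A -> derive_in A f x = derive1 f x.
Proof. by move=> nA; rewrite /derive_in incr_in_interior. Qed.

(* Main.v *)
(* Let S_n be the Leibniz sum.  The recursion
   S_(n+1) = x^(n+1) phi^(n+1) - (n+1) S_n gives S_n' = x^n phi^(n+1) by
   induction, and is also the quotient rule (S_n / x^(n+1))' =
   S_(n+1) / x^(n+2) at x <> 0.  At 0, put g = phi^(n+1) and subtract from S_n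
   the polynomial g(0) x^(n+1) / (n+1) + g'(0) x^(n+2) / (n+2): the derivative
   of the difference G is x^n (g(x) - g(0) - g'(0) x) = o(x^(n+1)), so
   G = o(x^(n+2)) by the mean value inequality, which says that
   S_n / x^(n+1), extended by g(0) / (n+1), has derivative g'(0) / (n+2). *)
Require Import Defs.
From HB Require Import structures.
From mathcomp Require Import all_boot all_order all_algebra.
From mathcomp Require Import all_classical all_reals all_analysis.
From mathcomp Require Import ring.

Set Implicit Arguments.
Unset Strict Implicit.
Unset Printing Implicit Defensive.

Import Order.TTheory GRing.Theory Num.Theory.
Import numFieldNormedType.Exports.

Local Open Scope classical_set_scope.
Local Open Scope ring_scope.

(** * Derivatives relative to a set, as limits along [incr_in] *)

Definition is_derive_in (R : realType) (A : set R) (f : R -> R) (x l : R) :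
  Prop := (fun h => h^-1 *: (f (h + x) - f x)) @ incr_in A x --> l.

#[local] Instance incr_in_filter (R : realType) (A : set R) (x : R) :
  Filter (incr_in A x).
Proof. exact: within_filter. Qed.

(** Since [x < b], small positive increments stay in [[a, b)], even at [x = a], so every set of the
    filter contains one of them. *)
Lemma incr_in_itvco_proper (R : realType) (a b x : R) :
  `[a, b[%classic x -> ProperFilter (incr_in `[a, b[ x).
Proof.
rewrite /= in_itv/= => /andP[ax xb]; apply: Build_ProperFilter_ex => P hP.
have {}hP : \forall h \near (0 : R)^'+, h != 0 -> `[a, b[%classic (h + x) -> P h.
  apply: (cvg_within (F := nbhs (0 : R))).
  have {}hP : \forall h \near (0 : R), h != 0 -> `[a, b[%classic (h + x) -> P h.
    by [].
  exact: hP.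
have hb : \forall h \near (0 : R)^'+, h < b - x.
  by apply: nbhs_right_lt; rewrite subr_gt0.
have h0 : \forall h \near (0 : R)^'+, 0 < h by exact: nbhs_right_gt.
have [h [[h_gt0 h_lt] Ph]] := filter_ex (filterI (filterI h0 hb) hP).
exists h; apply: Ph; first by rewrite gt_eqF.
by rewrite /= in_itv/= (le_trans ax) ?lerDr 1?ltW//= -ltrBrDr.
Qed.

Lemma near_incr_in (R : realType) (A : set R) (x : R) :
  \forall h \near incr_in A x, h != 0 /\ A (h + x).
Proof.
suff : \forall h \near (0 : R), h != 0 -> A (h + x) -> h != 0 /\ A (h + x) by [].
by near=> h; split.
Unshelve. all: by end_near. Qed.

Lemma incr_in_cvg0 (R : realType) (A : set R) (x : R) :
  incr_in A x --> (0 : R).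
Proof.
apply: (cvg_trans (cvg_within _)); exact: cvg_within.
Qed.

Lemma eq_in_is_derive_in (R : realType) (A : set R) (f g : R -> R) (x l : R) :
  A x -> (forall y, A y -> f y = g y) ->
  is_derive_in A f x l -> is_derive_in A g x l.
Proof.
move=> Ax fg; apply: cvg_trans; apply: near_eq_cvg.
apply: filterS (near_incr_in A x) => h [_ Ah].
by rewrite !fg.
Qed.

Lemma is_derive_in_near (R : realType) (A : set R) (f g : R -> R) (x l : R) :
  (\forall y \near x, f y = g y) -> is_derive_in A f x l ->
  is_derive_in A g x l.
Proof.
move=> fg; have gx := nbhs_singleton fg.
apply: cvg_trans; apply: near_eq_cvg.
have : \forall h \near incr_in A x, f (h + x) = g (h + x).
  apply: incr_in_cvg0; move/nbhs0P: fg.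
  by apply: filterS => h; rewrite addrC.
by apply: filterS => h ->; rewrite gx.
Qed.

(** The passage from limit statements to the value [derive_in]: limits are unique only along a
    proper filter. *)
Lemma is_derive_in_val (R : realType) (A : set R) (f : R -> R) (x l : R) :
  ProperFilter (incr_in A x) -> is_derive_in A f x l ->
  derivable_in A f x /\ derive_in A f x = l.
Proof.
move=> pF fl; split; first by apply/cvg_ex; exists l.
exact: cvg_lim fl.
Qed.

Lemma is_derive_is_derive_in (R : realType) (A : set R) (f : R -> R) (x l : R) :
  is_derive x 1 f l -> is_derive_in A f x l.
Proof.
case=> /cvg_within_filter - /(_ [set h | A (h + x)]).
rewrite /derive => + <-; apply: cvg_trans; apply: near_eq_cvg.
by apply: nearW => h; rewrite /= [h *: 1]mulr1.
Qed.

Lemma is_derive_in_cvg (R : realType) (A : set R) (f : R -> R) (x l : R) :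
  is_derive_in A f x l -> f (h + x) @[h --> incr_in A x] --> f x.
Proof.
move=> fl.
(* For [h != 0] the left side is [f (h + x)]. *)
have : f x + h * (h^-1 *: (f (h + x) - f x)) @[h --> incr_in A x] --> f x + 0 * l.
  apply: cvgD; first exact: cvg_cst.
  by apply: cvgM => //; exact: incr_in_cvg0.
rewrite mul0r addr0; apply: cvg_trans; apply: near_eq_cvg.
apply: filterS (near_incr_in A x) => h [h0 _].
by rewrite /GRing.scale/= mulVKf// addrC subrK.
Qed.

Lemma is_derive_in_within_continuous (R : realType) (A : set R)
    (f df : R -> R) :
  (forall x, A x -> is_derive_in A f x (df x)) -> {within A, continuous f}.
Proof.
move=> dfP; apply/subspace_continuousP => x Ax.
move=> P Pfx; have := is_derive_in_cvg (dfP x Ax) Pfx.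
have fxP := nbhs_singleton Pfx.
rewrite /incr_in => hP.
have {}hP : \forall h \near (0 : R), h != 0 -> A (h + x) -> P (f (h + x)) by [].
suff : \forall y \near x, A y -> P (f y) by [].
apply/nbhs0P; apply: filterS hP => h; rewrite (addrC x).
(* [incr_in] omits [h = 0]; there [P (f x)] holds because [P] is a neighbourhood of [f x]. *)
by have [->|h0] := eqVneq h 0; rewrite ?add0r//; apply.
Qed.

(** * Rules of differentiation *)

Lemma is_derive_inB (R : realType) (A : set R) (f g : R -> R) (x l m : R) :
  is_derive_in A f x l -> is_derive_in A g x m ->
  is_derive_in A (fun y => f y - g y) x (l - m).
Proof.
move=> fl gm; apply: cvg_trans (cvgB fl gm); apply: near_eq_cvg.
by apply: nearW => h; rewrite /GRing.scale/= !fctE; ring.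
Qed.

Lemma is_derive_inM (R : realType) (A : set R) (f g : R -> R) (x l m : R) :
  is_derive_in A f x l -> is_derive_in A g x m ->
  is_derive_in A (fun y => f y * g y) x (l * g x + f x * m).
Proof.
move=> fl gm.
(* The increment of [f * g] is split as [(f (h + x) - f x) * g (h + x) + f x * (g (h + x) - g
   x)]. *)
apply: cvg_trans (cvgD (cvgM fl (is_derive_in_cvg gm)) (cvgM (cvg_cst (f x)) gm)).
apply: near_eq_cvg; apply: nearW => h.
by rewrite /GRing.scale/= !fctE /=; ring.
Qed.

Lemma is_derive_exp (R : realType) (n : nat) (x : R) :
  is_derive x 1 (fun y => y ^+ n) (n%:R * x ^+ n.-1).
Proof.
by split; [exact: exprn_derivable|rewrite exp_derive [LHS]mulr1].
Qed.

Lemma is_derive_in_exp (R : realType) (A : set R) (n : nat) (x : R) :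
  is_derive_in A (fun y => y ^+ n) x (n%:R * x ^+ n.-1).
Proof.
by apply: is_derive_is_derive_in; exact: is_derive_exp.
Qed.

Lemma is_derive_in_cst (R : realType) (A : set R) (c x : R) :
  is_derive_in A (fun=> c) x 0.
Proof. exact: is_derive_is_derive_in. Qed.

(** * Mean value inequality on [[a, b)] *)

Lemma is_derive_in_interior (R : realType) (A : set R) (f : R -> R) (x l : R) :
  nbhs x A -> is_derive_in A f x l -> is_derive x 1 f l.
Proof.
move=> nA fl; have df : derivable f x 1.
  by apply: (derivable_in_interior f nA).1; apply/cvg_ex; exists l.
split=> //; rewrite -derive1E -(derive_in_interior f nA).
apply: (is_derive_in_val _ fl).2.
by rewrite incr_in_interior//; exact: Proper_dnbhs_numFieldType.
Qed.

(** Points strictly between [x] and [y] are interior to [[a, b)], even if one of the two is [a], so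
    the two-sided mean value theorem applies. Using [min] and [max] covers increments of either
    sign. *)
Lemma is_derive_in_bound (R : realType) (a b x y M : R) (G dG : R -> R) :
  `[a, b[%classic x -> `[a, b[%classic y ->
  (forall z, `[a, b[%classic z -> is_derive_in `[a, b[ G z (dG z)) ->
  (forall z, Num.min x y < z < Num.max x y -> `|dG z| <= M) ->
  `|G y - G x| <= M * `|y - x|.
Proof.
wlog xy : x y / x <= y.
  move=> H; have /orP[xy|yx] := le_total x y; first exact: H.
  move=> Ax Ay dGP dGM; rewrite distrC (distrC y); apply: H => // z.
  by rewrite minC maxC; exact: dGM.
rewrite /= !in_itv/= => /andP[ax xb] /andP[ay yb] dGP dGM.
move: xy; rewrite le_eqVlt => /predU1P[->|xy].
  by rewrite !subrr normr0 mulr0.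
rewrite min_l ?max_r ?ltW// in dGM.
have cG : {within `[x, y], continuous G}.
  apply: continuous_subspaceW (is_derive_in_within_continuous dGP) => z /=.
  by rewrite !in_itv/= => /andP[xz zy]; rewrite (le_trans ax)//= (le_lt_trans zy).
have dG' z : z \in `]x, y[%R -> is_derive z 1 G (dG z).
  rewrite in_itv/= => /andP[xz zy].
  have /andP[az zb] : a < z < b by rewrite (le_lt_trans ax)//= (lt_trans zy).
  apply: (@is_derive_in_interior _ `[a, b[%classic).
    have := @near_in_itvoo R a b z; rewrite in_itv/= az zb => /(_ isT).
    by apply: filterS => t; rewrite /= !in_itv/= => /andP[/ltW -> ->].
  by apply: dGP; rewrite /= in_itv/= ltW.
have [c + ->] := MVT xy dG' cG.
by rewrite in_itv/= => cxy; rewrite normrM ler_wpM2r// dGM.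
Qed.

(** * Derivative of [S x / x ^+ n.+1] at zero and away from zero *)

Lemma is_derive_in_div_exp0 (R : realType) (a b d : R) (n : nat)
    (S g : R -> R) :
  a <= 0 -> 0 < b -> S 0 = 0 ->
  (forall x, `[a, b[%classic x -> is_derive_in `[a, b[ S x (x ^+ n * g x)) ->
  is_derive_in `[a, b[ g 0 d ->
  is_derive_in `[a, b[
    (fun x => if x == 0 then n.+1%:R^-1 * g 0 else (x ^+ n.+1)^-1 * S x)
    0 (n.+2%:R^-1 * d).
Proof.
move=> a0 b0 S0 dS dg.
have A0 : `[a, b[%classic 0 by rewrite /= in_itv/= a0.
pose G x := S x - n.+1%:R^-1 * g 0 * x ^+ n.+1 - n.+2%:R^-1 * d * x ^+ n.+2.
pose dG x := x ^+ n * (g x - g 0 - d * x).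
have GdG z : `[a, b[%classic z -> is_derive_in `[a, b[ G z (dG z).
  move=> Az; have monoP c m :
      is_derive_in `[a, b[ (fun y => c * y ^+ m) z (c * (m%:R * z ^+ m.-1)).
    have := is_derive_inM (@is_derive_in_cst _ `[a, b[ c z)
      (@is_derive_in_exp _ _ m z).
    by rewrite mul0r add0r.
  have := is_derive_inB (is_derive_inB (dS z Az)
    (monoP (n.+1%:R^-1 * g 0) n.+1)) (monoP (n.+2%:R^-1 * d) n.+2).
  congr (is_derive_in _ _ _ _); rewrite /dG /=.
  rewrite exprS; field.
  by rewrite -natrD nat1r !pnatr_eq0.
apply/cvgrPdist_le => e e0.
have : \forall h \near (0 : R), h != 0 -> `[a, b[%classic (h + 0) ->
    `|d - h^-1 *: (g (h + 0) - g 0)| <= e.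
  by move/cvgrPdist_le : dg => /(_ e e0).
move=> /nbhs_norm0P[r /= r0 hr].
have near_r : \forall h \near incr_in `[a, b[ 0, `|h| < r.
  have : \forall h \near (0 : R), `|h| < r by apply/nbhs_norm0P; exists r.
  exact: incr_in_cvg0.
apply: filterS2 (near_incr_in `[a, b[ 0) near_r => h [h0 Ah] hlt.
rewrite addr0 in Ah *; rewrite eqxx (negbTE h0).
have GM : `|G h - G 0| <= e * `|h| ^+ n.+1 * `|h - 0|.
  apply: (is_derive_in_bound A0 Ah GdG) => z zh.
  have {}zh : 0 < z < h \/ h < z < 0.
    by move: h0 zh; case: (ltgtP 0 h) => // _ _; [left|right].
  have zle : `|z| <= `|h|.
    case: zh => /andP[z1 z2]; have hz := lt_trans z1 z2.
      by rewrite !gtr0_norm// ltW.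
    by rewrite !ltr0_norm// lerN2 ltW.
  have [->|z0] := eqVneq z 0.
    rewrite /dG mulr0 subr0 subrr mulr0 normr0.
    by rewrite mulr_ge0 ?exprn_ge0// ltW.
  have Az : `[a, b[%classic z.
    move: Ah; rewrite /= !in_itv/= => /andP[ah hb].
    case: zh => /andP[z1 z2].
      by rewrite (le_trans a0) ?(ltW z1)//= (lt_trans z2).
    by rewrite (le_trans ah) ?(ltW z1)//= (lt_trans z2).
  have := hr z (le_lt_trans zle hlt) z0; rewrite addr0 => /(_ Az) dz.
  (* The second factor is the error of the difference quotient of [g] at 0, at most [e] in absolute
     value by [dz]; the first is bounded by [zle]. *)
  have -> : dG z = z ^+ n.+1 * - (d - z^-1 *: (g z - g 0)).
    by rewrite /dG /GRing.scale/= exprS; field.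
  rewrite normrM normrN normrX mulrC ler_pM ?exprn_ge0//.
  by rewrite lerXn2r// nnegrE.
have G0 : G 0 = 0 by rewrite /G S0 !expr0n !mulr0 !subr0.
rewrite G0 !subr0 -mulrA -exprSr -normrX in GM.
(* The error of the difference quotient at 0 is exactly [- G h / h ^+ n.+2], so dividing [GM] by
   [|h| ^+ n.+2] bounds it by [e]. *)
have -> : n.+2%:R^-1 * d - h^-1 *: ((h ^+ n.+1)^-1 * S h - n.+1%:R^-1 * g 0)
   = - (G h / h ^+ n.+2).
  rewrite /G /GRing.scale/= !exprS; field.
  by rewrite h0 expf_neq0// -natrD nat1r !pnatr_eq0.
by rewrite normrN normf_div ler_pdivrMr// normr_gt0 expf_neq0.
Qed.

(** Quotient rule, with the numerator arranged so that [l = x ^+ n * phi^(n+1)] turns it into the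
    right side of [leibniz_sumS]. *)
Lemma is_derive_in_div_exp (R : realType) (A : set R) (n : nat)
    (S : R -> R) (x c l : R) :
  x != 0 -> is_derive_in A S x l ->
  is_derive_in A (fun y => if y == 0 then c else (y ^+ n.+1)^-1 * S y) x
    ((x ^+ n.+2)^-1 * (x * l - n.+1%:R * S x)).
Proof.
move=> x0 dS.
have xn0 : x ^+ n.+1 != 0 by rewrite expf_neq0.
apply: (@is_derive_in_near _ _ (fun y => (y ^+ n.+1)^-1 * S y)).
  have : \forall y \near x, y != 0 by exact: (cvgr_neq0 _ cvg_id x0).
  by apply: filterS => y /negbTE ->.
have dV : is_derive_in A (fun y => (y ^+ n.+1)^-1) x
    (- (x ^+ n.+1) ^- 2 *: (n.+1%:R * x ^+ n)).
  apply: is_derive_is_derive_in; apply: is_deriveV => //.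
  exact: is_derive_exp.
have := is_derive_inM dV dS.
congr (is_derive_in _ _ _ _).
rewrite /GRing.scale/= !exprS; field.
by rewrite x0 expf_neq0.
Qed.

(** * Leibniz sums *)

Lemma leibniz_sumS (R : realType) (A : set R) (phi : R -> R) (n : nat) (x : R) :
  leibniz_sum A phi n.+1 x =
  x ^+ n.+1 * deriven_in A n.+1 phi x - n.+1%:R * leibniz_sum A phi n x.
Proof.
(* The term [k = 0] is the isolated one; the others match after a shift of [k], by
   [(k+1) C(n+1, k+1) = (n+1) C(n, k)]. *)
rewrite /leibniz_sum big_ord_recl/= bin0 fact0 expr0 !subn0 !mul1r.
congr (_ + _); rewrite mulr_sumr -sumrN; apply: eq_bigr => k _.
rewrite /= /bump/= add1n subSS exprS factS.
have -> : 'C(n.+1, k.+1)%:R * (-1 * (-1) ^+ k) * (k.+1 * k`!)%:R =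
   - ((k.+1 * 'C(n.+1, k.+1))%:R * (-1) ^+ k * k`!%:R) :> R.
  by rewrite !natrM; ring.
by rewrite -mul_bin_diag natrM; ring.
Qed.

Lemma leibniz_sum_at0 (R : realType) (A : set R) (phi : R -> R) (n : nat) :
  phi 0 = 0 -> leibniz_sum A phi n 0 = 0.
Proof.
move=> phi0; elim: n => [|n IH]; last first.
  by rewrite leibniz_sumS IH mulr0 exprS !mul0r subr0.
by rewrite /leibniz_sum big_ord_recl big_ord0 /= phi0 mulr0 addr0.
Qed.

Lemma is_derive_in_leibniz_sum (R : realType) (A : set R) (phi : R -> R)
    (n : nat) (x : R) :
  A x ->
  (forall k, is_derive_in A (deriven_in A k phi) x (deriven_in A k.+1 phi x)) ->
  is_derive_in A (leibniz_sum A phi n) x (x ^+ n * deriven_in A n.+1 phi x).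
Proof.
move=> Ax dphi; elim: n => [|n IH].
  rewrite expr0 mul1r; apply: eq_in_is_derive_in (dphi 0%N) => // y _.
  by rewrite /leibniz_sum big_ord_recl big_ord0 /= bin0 fact0 !expr0 !mul1r addr0.
apply: (@eq_in_is_derive_in _ _ (fun y =>
  y ^+ n.+1 * deriven_in A n.+1 phi y - n.+1%:R * leibniz_sum A phi n y)) => //.
  by move=> y _; rewrite leibniz_sumS.
(* The term [(n+1) x^n phi^(n+1)] from the product rule cancels against [n+1] times the induction
   hypothesis. *)
have := is_derive_inB
  (is_derive_inM (@is_derive_in_exp _ A n.+1 x) (dphi n.+1))
  (is_derive_inM (@is_derive_in_cst _ A n.+1%:R x) IH).
by congr (is_derive_in _ _ _ _); rewrite /= mul0r add0r; ring.
Qed.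

(** * Derivatives of all orders of the extended quotient [phi x / x] *)

Theorem lemma2p10 (R : realType) (a b : R) (phi f : R -> R)
  (ha : a <= 0) (hb : 0 < b)
  (phi_smooth : forall n : nat, nderivable_in `[a, b[ n phi)
  (phi0 : phi 0 = 0)
  (fE : forall x : R, `[a, b[%classic x ->
    f x = if x == 0 then derive_in `[a, b[ phi 0 else phi x / x)
  (n : nat) :
  [/\ nderivable_in `[a, b[ n f,
      forall x : R, `[a, b[%classic x ->
        deriven_in `[a, b[ n f x =
          if x == 0 then (n.+1%:R)^-1 * deriven_in `[a, b[ n.+1 phi 0
          else (x ^+ n.+1)^-1 * leibniz_sum `[a, b[ phi n x,
      {within `[a, b[, continuous (deriven_in `[a, b[ n f)} &
      forall x : R, `[a, b[%classic x ->
        derivable_in `[a, b[ (leibniz_sum `[a, b[ phi n) x /\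
        derive_in `[a, b[ (leibniz_sum `[a, b[ phi n) x =
          x ^+ n * deriven_in `[a, b[ n.+1 phi x].
Proof.
set A := (X in nderivable_in X).
have dphi x k : A x ->
    is_derive_in A (deriven_in A k phi) x (deriven_in A k.+1 phi x).
  (* Convergence means convergence to the [lim], which is [deriven_in A k.+1 phi x] by
     definition. *)
  by move=> Ax; exact: phi_smooth (ltnSn k) x Ax.
have dS m x : A x ->
    is_derive_in A (leibniz_sum A phi m) x (x ^+ m * deriven_in A m.+1 phi x).
  by move=> Ax; apply: is_derive_in_leibniz_sum => // k; exact: dphi.
(* [F m] is the claimed formula. That [F m.+1] is its derivative on all of [A] is shown first,
   without [f]; induction on [m] then identifies [F m] with the derivatives of [f]. *)
pose F m (x : R) := if x == 0 then m.+1%:R^-1 * deriven_in A m.+1 phi 0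
              else (x ^+ m.+1)^-1 * leibniz_sum A phi m x.
have dF m x : A x -> is_derive_in A (F m) x (F m.+1 x).
  move=> Ax; rewrite {2}/F; case: eqVneq => [x0|x0].
    rewrite x0 in Ax *; apply: is_derive_in_div_exp0 => //.
    - exact: leibniz_sum_at0.
    - exact: dS.
    - exact: dphi.
  (* Regrouping as [x * (x ^+ m * phi^(m+1))] exposes the derivative of the Leibniz sum as the [l]
     of the quotient rule. *)
  rewrite leibniz_sumS [x ^+ m.+1]exprS -mulrA.
  exact: is_derive_in_div_exp x0 (dS m x Ax).
have fF m x : A x -> deriven_in A m f x = F m x.
  elim: m x => [|m IH] x Ax.
    rewrite /= fE// /F; case: eqP => _; first by rewrite invr1 mul1r.
    rewrite /leibniz_sum big_ord_recl big_ord0 /= bin0 fact0 !expr0 expr1.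
    by rewrite !mul1r addr0 mulrC.
  have pF : ProperFilter (incr_in A x) by exact: incr_in_itvco_proper.
  apply: (is_derive_in_val pF _).2.
  (* Equality on [A] is enough, as the difference quotients only see points of [A]. *)
  by apply: eq_in_is_derive_in (dF m x Ax) => // y Ay; exact: esym (IH y Ay).
have df m x : A x ->
    is_derive_in A (deriven_in A m f) x (F m.+1 x).
  by move=> Ax; apply: eq_in_is_derive_in (dF m x Ax) => // y Ay; rewrite fF.
split.
- by move=> k _ x Ax; apply/cvg_ex; exists (F k.+1 x); exact: df.
- exact: fF.
- exact: is_derive_in_within_continuous (df n).
- move=> x Ax; apply: is_derive_in_val (dS n x Ax).
  exact: incr_in_itvco_proper Ax.
Qed.
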